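(* Let $A$ be an Abelian group and let $G=(V,E)$ be a finite weakly connected directed graph (loops and multiple edges allowed). Let $\mathcal{WR}(V\cup E,A)$ be the group of balanced functions on the vertices and edges of $G$ in the rigid case, let $\bar{k}(G)$ be the number of strongly connected components of $G$, and let $r(G)$ be the number of all edges of $G$ which go from a vertex in one strongly connected component of $G$ to a vertex in a different strongly connected component of $G$. Then the group $\mathcal{WR}(V\cup E,A)$ is isomorphic to $A^{|V|}\times A^{|V|-\bar{k}(G)+r(G)}$.
   Context: The Abelian group $A$ is written additively with identity $0$. A directed graph $G=(V,E)$ has a nonempty vertex set $V$ and a set $E$ of directed edges, each with an origin and an endpoint in $V$; loops and multiple edges are allowed. It is weakly connected if its underlying undirected graph is connected. Rigid case (edges may be traversed only along their direction). A path from a vertex $x$ to a vertex $y$ is an alternating sequence $v_1,e_1,v_2,e_2,\dots,v_n,e_n$ of vertices from $V$ and pairwise different edges from $E$ such that $v_1=x$, each $e_j$ for $j=1,\dots,n-1$ goes from $v_j$ to $v_{j+1}$, and $e_n$ goes from $v_n$ to $y$; vertices may repeat. A cycle is a path from a vertex to itself. A function $h:V\cup E\to A$ is called balanced if $h(v_1)+h(e_1)+h(v_2)+h(e_2)+\dots+h(v_n)+h(e_n)=0$ for every cycle $v_1,e_1,\dots,v_n,e_n$ of $G$. The set $\mathcal{WR}(V\cup E,A)$ of all balanced functions $h:V\cup E\to A$ is a group under pointwise addition. Two vertices $x,y$ are strongly connected if there exist a path from $x$ to $y$ and a path from $y$ to $x$ (these may share edges); every vertex is strongly connected to itself. This is an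 equivalence relation on $V$; its equivalence classes, together with all the edges between the vertices of each class, are the strongly connected components of $G$. *)

(* Defs.v *)
From HB Require Import structures.
From mathcomp Require Import all_boot all_order all_algebra.
From mathcomp Require Import boolp.

Set Implicit Arguments.
Unset Strict Implicit.
Unset Printing Implicit Defensive.

Import GRing.Theory.
Local Open Scope ring_scope.

Record digraph := Digraph {
  vertex : finType;
  edge : finType;
  origin : edge -> vertex;
  endpoint : edge -> vertex;
  vertex_nonempty : (0 < #|vertex|)%N }.

Arguments origin {d} _.
Arguments endpoint {d} _.

Section Digraph.
Variable G : digraph.
Notation V := (vertex G).
Notation E := (edge G).

Definition adjacent : rel V := fun u v =>
  [exists e : E, ((origin e == u) && (endpoint e == v))
              || ((origin e == v) && (endpoint e == u))].

Definition weakly_connected : Prop := forall x y : V, connect adjacent x y.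

(* The sequence v_1, e_1, ..., v_n, e_n is encoded as the list of pairs
   (v_1, e_1), ..., (v_n, e_n); the empty list is excluded in [is_path]. *)
Fixpoint is_walk (x y : V) (p : seq (V * E)) : bool :=
  if p is (v, e) :: q then
    [&& v == x, origin e == v & is_walk (endpoint e) y q]
  else x == y.

Definition is_path (x y : V) (p : seq (V * E)) : bool :=
  [&& p != [::], is_walk x y p & uniq [seq ve.2 | ve <- p]].

Definition is_cycle (p : seq (V * E)) : Prop := exists x, is_path x x p.

Definition strongly_connected : rel V := fun x y =>
  (x == y) || `[< (exists p, is_path x y p) /\ (exists q, is_path y x q) >].

(* A component is represented by its set of vertices, which determines its
   edges. *)
Definition strong_components : {set {set V}} :=
  equivalence_partition strongly_connected [set: V].

Definition kbar : nat := #|strong_components|.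

Definition rbar : nat :=
  #|[set e : E | pblock strong_components (origin e)
                 != pblock strong_components (endpoint e)]|.

Section Balanced.
Variable A : zmodType.

Definition balanced (h : {ffun V + E -> A}) : Prop :=
  forall p, is_cycle p -> \sum_(ve <- p) (h (inl ve.1) + h (inr ve.2)) = 0.

Definition balanced_pred : {pred {ffun V + E -> A}} := fun h => `[< balanced h >].

Lemma balanced_zmod_closed : zmod_closed balanced_pred.
Proof.
split=> [|f g /asboolP Hf /asboolP Hg]; apply/asboolP => p Hp.
  by rewrite big1 // => ve _; rewrite !ffunE addr0.
rewrite (eq_bigr (fun ve => (f (inl ve.1) + f (inr ve.2))
                            - (g (inl ve.1) + g (inr ve.2)))).
  by rewrite sumrB Hf // Hg // subr0.
by move=> ve _; rewrite !ffunE opprD addrACA.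
Qed.

HB.instance Definition _ :=
  GRing.isZmodClosed.Build {ffun V + E -> A} balanced_pred balanced_zmod_closed.

Record WR := MkWR { wr_fun :> {ffun V + E -> A}; _ : wr_fun \in balanced_pred }.

HB.instance Definition _ := [isSub for wr_fun].
HB.instance Definition _ := [Choice of WR by <:].
HB.instance Definition _ := [SubChoice_isSubZmodule of WR by <:].

End Balanced.
End Digraph.

Definition group_isomorphic (B C : zmodType) : Prop :=
  exists f : {additive B -> C}, bijective f.

(* Main.v *)
Require Import Defs.
From HB Require Import structures.
From mathcomp Require Import all_boot all_order all_algebra.
From mathcomp Require Import boolp.
From mathcomp Require Import zify.

(** Attach to each edge [e] of a function [h] the gain
    [h (origin e) + h e].  The alternating sum of [h] along a walk is the sum of
    the gains of its edges, so [h] amounts to arbitrary values on the vertices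
    together with a gain function on the edges, and only the gains are
    constrained: they have to add up to zero along every cycle.

    A walk which uses an edge twice contains a shorter closed walk, which may be
    cut out ([walk_repeated_edge]).  Hence balancedness forces the sum along
    every closed walk to vanish, not only along those with distinct edges
    ([balanced_closed_walk]), and strong connectedness is just the existence of
    walks both ways ([strongly_connectedP]).

    An edge lies on a closed walk if and only if it is internal, that is, both
    of its ends lie in one strong component.  So the gains of the other edges
    are free.  On a component, all walks between two given vertices have the same
    sum, so there the gain of an edge is the increment of a potential
    ([potential_increment]); conversely the increments of any potential
    telescope to zero along cycles ([potential_balanced]).  The potential is
    unique once it is required to vanish at one chosen root in each component,
    and is then arbitrary at the other vertices.

    The coordinates of a balanced function are thus its values at the vertices,
    the potential at the vertices other than the roots, and the gains of the
    edges between components; they can be prescribed at will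
    ([coordinatesK], [of_coordinatesK]), and their numbers are [#|V|],
    [#|V| - kbar G] and [rbar G]. *)

Set Implicit Arguments.
Unset Strict Implicit.
Unset Printing Implicit Defensive.

Import GRing.Theory.

Lemma bijective_group_isomorphic (B C : zmodType) (f : B -> C) :
  zmod_morphism f -> bijective f -> group_isomorphic B C.
Proof.
move=> fB bij_f.
pose F : {additive B -> C} :=
  HB.pack_for {additive B -> C} f (GRing.isZmodMorphism.Build B C f fB).
by exists F.
Qed.

Section Graph.
Local Open Scope ring_scope.
Variable G : digraph.
Notation V := (vertex G).
Notation E := (edge G).
Implicit Types (x y : V) (e : E) (p q : seq (V * E)).

(** * Walks *)

Lemma walk_catP x y p q :
  reflect (exists2 z, is_walk x z p & is_walk z y q) (is_walk x y (p ++ q)).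
Proof.
elim: p x => [|[v e] p IHp] x /=.
  by apply: (iffP idP) => [?|[z /eqP->]]; first by exists x.
apply: (iffP and3P) => [[vx ev /IHp[z xz zy]]|[z /and3P[vx ev pz] zy]].
  by exists z => //; apply/and3P.
by split=> //; apply/IHp; exists z.
Qed.

Lemma walk_cat x z y p q :
  is_walk x z p -> is_walk z y q -> is_walk x y (p ++ q).
Proof. by move=> xz zy; apply/walk_catP; exists z. Qed.

Lemma walk_edge e : is_walk (origin e) (endpoint e) [:: (origin e, e)].
Proof. by rewrite /= !eqxx. Qed.

(** Since each edge determines its origin, the two passages through a repeated
    edge start at the same vertex, and what lies between them is closed.  The
    second passage is kept, so that the shortened walk is not empty. *)
Lemma walk_repeated_edge x y p :
    is_walk x y p -> ~~ uniq [seq ve.2 | ve <- p] ->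
  exists z p1 c p2, [/\ p = p1 ++ c ++ p2, c != [::], p2 != [::],
                        is_walk z z c & is_walk x y (p1 ++ p2)].
Proof.
elim: p x => // -[v e] p IHp x /= /and3P[/eqP-> /eqP ex pW].
rewrite negb_and negbK => /orP[/mapP[[w f] wf_p /= ef]|/(IHp _ pW)]; last first.
  move=> [z [p1 [c [p2 [-> c0 p20 cW pW']]]]].
  by exists z, ((x, e) :: p1), c, p2; split; rewrite //= ex !eqxx.
subst f; case/splitPr: wf_p pW => p1 p2 /walk_catP[z p1W].
case/and3P=> /eqP wz /eqP ez p2W; subst.
by exists (origin e), [::], ((origin e, e) :: p1), ((origin e, e) :: p2);
  split; rewrite //= !eqxx.
Qed.

Lemma walk_path x y p : p != [::] -> is_walk x y p -> exists q, is_path x y q.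
Proof.
have [n] := ubnP (size p); elim: n p => // n IHn p ltpn p0 pW.
have [p_uniq|/(walk_repeated_edge pW)] := boolP (uniq [seq ve.2 | ve <- p]).
  by exists p; apply/and3P.
move=> [z [p1 [c [p2 [def_p c0 p20 _ pW']]]]]; apply: IHn pW'.
  move: ltpn; rewrite def_p !size_cat.
  have : (0 < size c)%N by rewrite lt0n size_eq0.
  lia.
by rewrite -size_eq0 size_cat addn_eq0 !size_eq0 negb_and p20 orbT.
Qed.

Lemma strongly_connectedP x y :
  reflect ((exists p, is_walk x y p) /\ (exists q, is_walk y x q))
          (strongly_connected x y).
Proof.
apply: (iffP orP) => [[/eqP<-|/asboolP[]]|].
- by split; exists [::]; rewrite /= eqxx.
- by move=> [p /and3P[_ pW _]] [q /and3P[_ qW _]]; split; [exists p|exists q].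
case: eqVneq => [_|neq_xy]; first by left.
have nonempty u v p : u != v -> is_walk u v p -> exists q, is_path u v q.
  by case: p => [|ve p _ /walk_path]; [move=> /negPf /= ->|apply].
move=> [[p pW] [q qW]]; right; apply/asboolP.
by split; [apply: nonempty pW|apply: nonempty qW; rewrite eq_sym].
Qed.

(** * Strong components and their roots *)

Lemma strongly_connected_equivalence :
  equivalence_rel (@strongly_connected G).
Proof.
apply/equivalence_relP; split=> [x|x y xy z].
  by rewrite /strongly_connected eqxx.
have [[p pW] [q qW]] := strongly_connectedP _ _ xy.
apply/strongly_connectedP/strongly_connectedP.
  move=> [[r rW] [s sW]]; split; [exists (q ++ r)|exists (s ++ p)].
    exact: walk_cat rW.
  exact: walk_cat pW.
move=> [[r rW] [s sW]]; split; [exists (p ++ r)|exists (s ++ q)].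
  exact: walk_cat rW.
exact: walk_cat qW.
Qed.

Let sc_equiv :
  {in [set: V] & &, equivalence_rel (@strongly_connected G)}.
Proof. by move=> x y z _ _ _; apply: strongly_connected_equivalence. Qed.

Lemma strong_components_partition :
  partition (strong_components G) [set: V].
Proof. exact: equivalence_partitionP sc_equiv. Qed.

Lemma eq_pblock_strong x y :
  (pblock (strong_components G) x == pblock (strong_components G) y)
    = strongly_connected x y.
Proof.
have /and3P[/eqP covP trivP _] := strong_components_partition.
rewrite eq_pblock ?covP ?inE //.
exact: (pblock_equivalence_partition sc_equiv (in_setT x) (in_setT y)).
Qed.

Definition roots : {set V} := transversal (strong_components G) [set: V].

Definition root x : V :=
  transversal_repr x roots (pblock (strong_components G) x).

Let rootsP := transversalP strong_components_partition.

Let pblock_strong x :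
  pblock (strong_components G) x \in strong_components G.
Proof. by rewrite pblock_mem ?(cover_partition strong_components_partition). Qed.

Lemma mem_root x : root x \in roots.
Proof. exact: repr_mem_transversal rootsP _ _ (pblock_strong x). Qed.

Lemma root_strongly_connected x : strongly_connected (root x) x.
Proof.
by rewrite -eq_pblock_strong (transversal_reprK rootsP) ?pblock_strong.
Qed.

Lemma eq_root x y : strongly_connected x y -> root x = root y.
Proof.
rewrite -eq_pblock_strong => /eqP eq_xy.
apply: (pblock_inj rootsP); rewrite ?mem_root //.
by rewrite !(transversal_reprK rootsP) ?pblock_strong.
Qed.

Lemma root_id x : x \in roots -> root x = x.
Proof. exact: (pblockK rootsP). Qed.

Lemma root_walk_exists x : exists p, is_walk (root x) x p.
Proof. by case/strongly_connectedP: (root_strongly_connected x). Qed.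

Definition root_walk x := xchoose (root_walk_exists x).

Lemma root_walkP x : is_walk (root x) x (root_walk x).
Proof. exact: xchooseP. Qed.

Definition internal : pred E :=
  fun e => strongly_connected (origin e) (endpoint e).

(** * Sums along walks *)

Variable A : zmodType.
Implicit Types (h : {ffun V + E -> A}) (phi : V -> A).

Definition gain h e : A := h (inl (origin e)) + h (inr e).

Definition walk_sum h p : A :=
  \sum_(ve <- p) (h (inl ve.1) + h (inr ve.2)).

Lemma walk_sum_cat h p q : walk_sum h (p ++ q) = walk_sum h p + walk_sum h q.
Proof. exact: big_cat. Qed.

Lemma walk_sum_edge h e : walk_sum h [:: (origin e, e)] = gain h e.
Proof. exact: big_seq1. Qed.

Lemma walk_sumB h h' p : walk_sum (h - h') p = walk_sum h p - walk_sum h' p.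
Proof.
by rewrite /walk_sum -sumrB; apply: eq_bigr => ve _;
  rewrite !ffunE opprD addrACA.
Qed.

(** A closed walk with a repeated edge splits into two shorter closed walks, so
    induction on the length reduces the claim to cycles. *)
Lemma balanced_closed_walk h x p :
  balanced h -> is_walk x x p -> walk_sum h p = 0.
Proof.
move=> hB; have [n] := ubnP (size p).
elim: n x p => // n IHn x p ltpn pW.
have [->|p0] := eqVneq p [::]; first exact: big_nil.
have [p_uniq|/(walk_repeated_edge pW)] := boolP (uniq [seq ve.2 | ve <- p]).
  by apply: hB; exists x; apply/and3P.
move=> [z [p1 [c [p2 [def_p c0 p20 cW pW']]]]].
move: ltpn; rewrite def_p !size_cat => ltpn.
have c_gt0 : (0 < size c)%N by rewrite lt0n size_eq0.
have p2_gt0 : (0 < size p2)%N by rewrite lt0n size_eq0.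
have -> : walk_sum h (p1 ++ c ++ p2) = walk_sum h (p1 ++ p2) + walk_sum h c.
  by rewrite !walk_sum_cat -addrA (addrC (walk_sum h p2)).
rewrite (IHn _ _ _ cW) ?(IHn _ _ _ pW') ?addr0 ?size_cat //; lia.
Qed.

(** The way back from [y] to [x] closes the walk at each of its edges, so it
    meets internal edges only, and the increments telescope. *)
Lemma walk_sum_potential h phi x y p :
    (forall e, internal e -> gain h e = phi (endpoint e) - phi (origin e)) ->
    strongly_connected x y -> is_walk x y p ->
  walk_sum h p = phi y - phi x.
Proof.
move=> h_phi /strongly_connectedP[_ [q]].
elim: p x q => [|[v e] p IHp] x q qW /=.
  by move=> /eqP->; rewrite subrr; apply: big_nil.
case/and3P=> /eqP-> /eqP def_x pW; subst x.
have e_internal : internal e.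
  apply/strongly_connectedP; split.
    by exists [:: (origin e, e)]; apply: walk_edge.
  by exists (p ++ q); apply: walk_cat qW.
rewrite -cat1s walk_sum_cat walk_sum_edge h_phi //.
rewrite (IHp (endpoint e) (q ++ [:: (origin e, e)])) //.
  by rewrite addrC addrA subrK.
exact: walk_cat qW (walk_edge e).
Qed.

Lemma potential_balanced h phi :
    (forall e, internal e -> gain h e = phi (endpoint e) - phi (origin e)) ->
  balanced h.
Proof.
move=> h_phi p [x /and3P[_ pW _]].
rewrite -/(walk_sum h p) (walk_sum_potential h_phi _ pW) ?subrr //.
by rewrite /strongly_connected eqxx.
Qed.

(** * The potential of a balanced function *)

Definition potential h x : A := walk_sum h (root_walk x).

(** Closing up by a common walk back to the root shows that the sum along the
    chosen walk to [x] followed by [p] is the sum along the one to [y]. *)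
Lemma walk_sum_increment h x y p :
    balanced h -> strongly_connected x y -> is_walk x y p ->
  walk_sum h p = potential h y - potential h x.
Proof.
move=> hB xy pW.
have /strongly_connectedP[_ [q qW]] := root_strongly_connected y.
have /(balanced_closed_walk hB) := walk_cat (root_walkP y) qW.
rewrite walk_sum_cat => /(canRL (addrK _)); rewrite sub0r => yq.
have xpW := walk_cat (root_walkP x) pW; rewrite (eq_root xy) in xpW.
have /(balanced_closed_walk hB) := walk_cat xpW qW.
rewrite !walk_sum_cat => /(canRL (addrK _)); rewrite sub0r => xpq.
by rewrite /potential yq -xpq addrC addKr.
Qed.

Lemma potential_increment h e : balanced h -> internal e ->
  gain h e = potential h (endpoint e) - potential h (origin e).
Proof.
by move=> hB eI; rewrite -walk_sum_edge (walk_sum_increment hB eI) ?walk_edge.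
Qed.

Lemma potential_root h x : balanced h -> x \in roots -> potential h x = 0.
Proof.
move=> hB /root_id xR; apply: (balanced_closed_walk (x := x) hB).
by rewrite -{1}xR root_walkP.
Qed.

(** * Coordinates on the group of balanced functions *)

(** The places where a free value can be prescribed once the values at the
    vertices are fixed: a potential at a vertex, or a gain on an edge. *)
Definition free_place : finType :=
  ({x : V | x \notin roots} + {e : E | ~~ internal e})%type.

Lemma card_free_place : #|free_place| = (#|V| - kbar G + rbar G)%N.
Proof.
rewrite card_sum !card_sig; congr (_ + _)%N.
  have <- : #|roots| = kbar G := card_transversal rootsP.
  by rewrite -(cardC roots) addKn; apply: eq_card.
by apply: eq_card => e; rewrite !inE eq_pblock_strong.
Qed.

Definition free_value h (d : free_place) : A :=
  match d with
  | inl x => potential h (val x)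
  | inr e => gain h (val e)
  end.

Definition extend_potential (s : free_place -> A) x : A :=
  if insub x is Some u then s (inl u) else 0.

Definition extend_gain (s : free_place -> A) e : A :=
  if insub e is Some f then s (inr f)
  else extend_potential s (endpoint e) - extend_potential s (origin e).

Definition of_coordinates_fun (a : V -> A) (s : free_place -> A) :
    {ffun V + E -> A} :=
  [ffun z => match z with
             | inl x => a x
             | inr e => extend_gain s e - a (origin e)
             end].

Lemma gain_of_coordinates a s e :
  gain (of_coordinates_fun a s) e = extend_gain s e.
Proof. by rewrite /gain !ffunE addrC subrK. Qed.

Lemma gain_of_coordinates_internal a s e : internal e ->
  gain (of_coordinates_fun a s) e
    = extend_potential s (endpoint e) - extend_potential s (origin e).
Proof.
by move=> eI; rewrite gain_of_coordinates /extend_gain insubF // eI.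
Qed.

Lemma of_coordinates_balanced a s :
  of_coordinates_fun a s \in @balanced_pred G A.
Proof.
apply/asboolP/(potential_balanced (phi := extend_potential s)) => e.
exact: gain_of_coordinates_internal.
Qed.

(** Both functions increase by the sum along the chosen walk, and both vanish
    at the roots. *)
Lemma potential_of_coordinates a s :
  potential (of_coordinates_fun a s) =1 extend_potential s.
Proof.
move=> x; rewrite /potential.
rewrite (walk_sum_potential (gain_of_coordinates_internal a s)
          (root_strongly_connected x) (root_walkP x)).
by rewrite [X in _ - X]/extend_potential insubF ?mem_root // subr0.
Qed.

Definition coordinates (h : WR G A) :
    {ffun 'I_#|V| -> A} * {ffun 'I_#|free_place| -> A} :=
  ([ffun i => wr_fun h (inl (enum_val i))],
   [ffun j => free_value (wr_fun h) (enum_val j)]).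

Definition of_coordinates
    (t : {ffun 'I_#|V| -> A} * {ffun 'I_#|free_place| -> A}) : WR G A :=
  MkWR (of_coordinates_balanced (t.1 \o enum_rank) (t.2 \o enum_rank)).

Lemma coordinates_zmod_morphism : zmod_morphism coordinates.
Proof.
move=> h h'; congr (_, _); apply/ffunP => i; rewrite !ffunE //.
case: (enum_val i) => [x|e] /=; first exact: walk_sumB.
by rewrite /gain !ffunE opprD addrACA.
Qed.

Lemma of_coordinatesK : cancel of_coordinates coordinates.
Proof.
move=> [a s]; congr (_, _); apply/ffunP => i; rewrite ffunE /=.
  by rewrite ffunE /= enum_valK.
rewrite -[in RHS](enum_valK i); case: (enum_val i) => [x|e] /=.
  by rewrite potential_of_coordinates /extend_potential valK.
by rewrite gain_of_coordinates /extend_gain valK.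
Qed.

Lemma coordinatesK : cancel coordinates of_coordinates.
Proof.
move=> h; apply: val_inj; have /asboolP hB := valP h.
have phiE x : extend_potential ((coordinates h).2 \o enum_rank) x
              = potential (wr_fun h) x.
  rewrite /extend_potential; case: insubP => [u _ <-|/negbNE xR].
    by rewrite /= ffunE enum_rankK.
  by rewrite potential_root.
apply/ffunP => -[x|e]; rewrite ffunE /= !ffunE enum_rankK //.
suff -> : extend_gain ((coordinates h).2 \o enum_rank) e = gain (wr_fun h) e.
  by rewrite /gain addrC addKr.
rewrite /extend_gain; case: insubP => [f _ <-|/negbNE eI].
  by rewrite /= ffunE enum_rankK.
by rewrite !phiE potential_increment.
Qed.

End Graph.

Theorem theorem3p8 (A : zmodType) (G : digraph) (HG : weakly_connected G) :
  group_isomorphic (WR G A)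
    ({ffun 'I_#|vertex G| -> A}
     * {ffun 'I_(#|vertex G| - kbar G + rbar G) -> A})%type.
Proof.
rewrite -card_free_place.
apply: bijective_group_isomorphic (@coordinates_zmod_morphism G A) _.
exact: Bijective (@coordinatesK G A) (@of_coordinatesK G A).
Qed.
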